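(* Let $A\in\mathbb{R}^{n\times n}$ be symmetric with eigenvalues $\alpha_1\ge\cdots\ge\alpha_n$, let $g\in\mathbb{R}^n$ be nonzero, $\Delta>0$, and consider the trust-region subproblem (TRS) of minimizing $f(x)=\frac12x^TAx+x^Tg$ subject to $\|x\|\le\Delta$, in the easy case. Let $x_{opt},\lambda_{opt}$, $A_{opt}$, $\kappa$, $Q_k$, $x_k$, $k_{\max}$ and $\epsilon_k$ be as in the context. If $\|x_{opt}\|=\|x_k\|=\Delta$ for $k\in\{1,2,\ldots,k_{\max}\}$, then $$0\le f(x_k)-f(x_{opt})\le \frac12\|A_{opt}\|\Big(1+\frac{\epsilon_k^2}{\Delta^2}\Big)\epsilon_k^2\le 2\|A_{opt}\|(\Delta^2+\epsilon_k^2)\Big(\frac{\sqrt\kappa-1}{\sqrt\kappa+1}\Big)^{2k},$$ and $$\|x_k-x_{opt}\|\le\sqrt{\kappa\Big(1+\frac{\epsilon_k^2}{\Delta^2}\Big)}\,\epsilon_k\le 2\sqrt{\kappa(\Delta^2+\epsilon_k^2)}\Big(\frac{\sqrt\kappa-1}{\sqrt\kappa+1}\Big)^{k}.$$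
   Context: All norms are Euclidean. $x_{opt}$ is a global minimizer of the TRS and $\lambda_{opt}\ge0$ its Lagrange multiplier: $(A+\lambda_{opt}I)x_{opt}=-g$, $\lambda_{opt}(\Delta-\|x_{opt}\|)=0$, $A+\lambda_{opt}I\succeq0$. Easy case means $\lambda_{opt}>-\alpha_n$ (so $A+\lambda_{opt}I\succ0$ and $x_{opt}$ is unique). Set $A_{opt}=A+\lambda_{opt}I$ and $\kappa=(\alpha_1+\lambda_{opt})/(\alpha_n+\lambda_{opt})$. The Lanczos process on $A$ with starting vector $g$ produces $Q_k=[q_1,\ldots,q_k]$ with orthonormal columns spanning the Krylov subspace $\mathcal{K}_k(A,g)=\mathrm{span}\{g,Ag,\ldots,A^{k-1}g\}$, $q_1=g/\|g\|$, the symmetric tridiagonal $T_k=Q_k^TAQ_k$, and $AQ_k=Q_kT_k+\beta_kq_{k+1}e_k^T$ ($e_k$ the $k$-th unit vector, $\beta_k\ge0$); $k_{\max}$ is the first step at which the Lanczos process breaks down. The GLTR iterate is $x_k=Q_kh_k$, where $h_k$ minimizes $\frac12h^TT_kh+\|g\|h^Te_1$ over $\|h\|\le\Delta$, with Lagrange multiplier $\lambda_k\ge0$: $(T_k+\lambda_kI)h_k=-\|g\|e_1$, $\lambda_k(\Delta-\|h_k\|)=0$, $T_k+\lambda_kI\succeq0$ (this reduced problem has a unique solution). Finally $\epsilon_k=\min_{x\in\mathcal{K}_k(A,g)}\|x-x_{opt}\|=\|(I-Q_kQ_k^T)x_{opt}\|$. *)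

(* Defs.v *)
From mathcomp Require Import all_boot all_order all_algebra.
From mathcomp Require Import boolp classical_sets reals.
Set Implicit Arguments. Unset Strict Implicit. Unset Printing Implicit Defensive.
Import Order.TTheory GRing.Theory Num.Theory.
Local Open Scope ring_scope.
Local Open Scope classical_set_scope.

Definition dotv (R : realType) (n : nat) (u v : 'cV[R]_n) : R := (u^T *m v) 0 0.
Definition vnorm (R : realType) (n : nat) (u : 'cV[R]_n) : R := Num.sqrt (dotv u u).

Definition trs_obj (R : realType) (n : nat) (A : 'M[R]_n) (g x : 'cV[R]_n) : R :=
  2^-1 * dotv x (A *m x) + dotv x g.

Definition psd (R : realType) (n : nat) (M : 'M[R]_n) : Prop :=
  forall v : 'cV[R]_n, 0 <= dotv v (M *m v).

Definition opnorm (R : realType) (n : nat) (M : 'M[R]_n) : R :=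
  sup [set vnorm (M *m x) | x in [set x : 'cV[R]_n | vnorm x <= 1]].

(* Krylov matrix: its rows are (A^i g)^T, i < k; its row space is K_k(A,g) *)
Definition krylov (R : realType) (n : nat) (A : 'M[R]_n) (g : 'cV[R]_n) (k : nat)
  : 'M[R]_(k, n) := \matrix_(i < k) (A ^+ i *m g)^T.

(* the Lanczos process breaks down at step k: K_{k+1}(A,g) = K_k(A,g) *)
Definition lanczos_breakdown (R : realType) (n : nat) (A : 'M[R]_n) (g : 'cV[R]_n)
  (k : nat) : bool := \rank (krylov A g k.+1) == \rank (krylov A g k).

Definition first_breakdown (R : realType) (n : nat) (A : 'M[R]_n) (g : 'cV[R]_n)
  (kmax : nat) : Prop :=
  (1 <= kmax)%N /\ lanczos_breakdown A g kmax /\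
  (forall j, (1 <= j < kmax)%N -> ~~ lanczos_breakdown A g j).

(* Q_k = [q_0, ..., q_{k-1}] (paper's q_1..q_k) *)
Definition Qmat (R : realType) (n : nat) (q : nat -> 'cV[R]_n) (k : nat) : 'M[R]_(n, k) :=
  \matrix_(i < n, j < k) q j i 0.

Definition lanczos_basis (R : realType) (n : nat) (A : 'M[R]_n) (g : 'cV[R]_n)
  (k : nat) (q : nat -> 'cV[R]_n) : Prop :=
  (forall i j, (i < k)%N -> (j < k)%N -> dotv (q i) (q j) = (i == j)%:R) /\
  q 0%N = (vnorm g)^-1 *: g /\
  (forall j, (j <= k)%N -> (\matrix_(i < j) (q i)^T == krylov A g j)%MS).

Definition e1 (R : realType) (k : nat) : 'cV[R]_k := \col_(i < k) ((i == 0 :> nat)%:R).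

(* Main.v *)
(* On the sphere |x| = Delta the gap f(x) - f(x_opt) equals the quadratic form
   (x - x_opt)^T A_opt (x - x_opt) / 2, because x_opt is stationary for
   f + lambda_opt |.|^2 / 2.  As x_k is optimal among the Krylov vectors of norm
   at most Delta, its gap is at most that of the projection of x_opt onto the
   Krylov space rescaled to norm Delta, whose squared distance to x_opt is at
   most (1 + eps^2 / Delta^2) eps^2.  Finally eps <= |r(A_opt) x_opt| for every
   polynomial r of degree at most k with r(0) = 1, since r(A_opt) x_opt - x_opt
   lies in the Krylov space; a shifted and scaled Chebyshev polynomial gives
   eps <= 2 Delta rho^k. *)

Require Import Defs.
From mathcomp Require Import all_boot all_order all_algebra.
From mathcomp Require Import boolp classical_sets reals.
From mathcomp Require Import complex.
From mathcomp Require Import zify ring lra.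
Set Implicit Arguments. Unset Strict Implicit. Unset Printing Implicit Defensive.
Import Order.TTheory GRing.Theory Num.Theory.
Local Open Scope ring_scope.
Local Open Scope sesquilinear_scope.

(** * Positivity of polynomials in a symmetric matrix *)

(* The spectral theorem is applied over R[i]; the diagonal entries are real and are
   eigenvalues of A over R. *)
Lemma psd_horner_mx (R : realType) (n : nat) (A : 'M[R]_n.+1) (p : {poly R}) :
  A^T = A -> (forall a, eigenvalue A a -> 0 <= p.[a]) -> psd (horner_mx A p).
Proof.
move=> symA p_ge0 v.
pose toC := real_complex R.
pose B := map_mx toC A.
have conj_toC (x : R) : Num.conj (toC x) = toC x by exact: conjc_real.
have Bherm : B \is hermsymmx.
  apply/is_hermitianmxP; rewrite expr0 scale1r; apply/matrixP => i j.
  by rewrite !mxE -[in LHS]symA mxE conj_toC.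
have Breal := hermitian_spectral_diag_real Bherm.
have /orthomx_spectralP Bdec := hermitian_normalmx Bherm.
set P := spectralmx B in Bdec; set D := spectral_diag B in Bdec Breal.
have Pu : P \in unitmx by exact: spectral_unit.
have PB : P *m B = diag_mx D *m P by rewrite Bdec -mulmxA mulKVmx.
have pD i : 0 <= (map_poly toC p).[D 0 i].
  have /mxOverP/(_ 0 i)/complex_realP[d Di] := Breal.
  rewrite Di horner_map /= ler0c p_ge0 //.
  (* Row [i] of [P] is a left eigenvector of [B] for [D 0 i], nonzero because [P] is invertible. *)
  rewrite -(eigenvalue_map toC) -/B; apply/eigenvalueP; exists (row i P).
    by rewrite -row_mul PB mul_diag_mx; apply/rowP => j; rewrite !mxE Di.
  apply/eqP => Pi0.
  have : row i P *m invmx P = row i 1%:M by rewrite -row_mul mulmxV.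
  rewrite Pi0 mul0mx => /rowP/(_ i); rewrite !mxE eqxx => /eqP.
  by rewrite eq_sym oner_eq0.
have pB : horner_mx B (map_poly toC p) =
    P^t* *m diag_mx (map_mx (horner (map_poly toC p)) D) *m P.
  by rewrite Bdec horner_mx_uconjC // horner_mx_diag invmx_unitary // spectral_unitarymx.
(* In the coordinates [w] of the eigenbasis the quadratic form is the sum of p(D_i) |w_i|^2. *)
pose w := P *m map_mx toC v.
have -> : 0 <= dotv v (horner_mx A p *m v) =
    (0 <= \sum_i (map_poly toC p).[D 0 i] * (w i 0 * Num.conj (w i 0))).
  rewrite -ler0c -/toC; congr (0 <= _).
  transitivity ((map_mx toC (v^T *m (horner_mx A p *m v))) 0 0).
    by rewrite mxE.
  rewrite !map_mxM map_horner_mx -/B pB -!mulmxA -/w mulmxA.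
  have -> : map_mx toC v^T *m P^t* = w^t*.
    rewrite /w trmx_mul map_mxM; congr (_ *m _).
    by apply/matrixP => i j; rewrite !mxE; apply: esym; exact: conj_toC.
  rewrite mxE; apply: eq_bigr => i _.
  rewrite mul_diag_mx !mxE. ring.
by apply: sumr_ge0 => i _; rewrite mulr_ge0 // mul_conjC_ge0.
Qed.

(** * Chebyshev polynomials and the residual polynomial *)

Section Chebyshev.
Variable R : rcfType.

(* The pair (T_k, U_(k-1)) of Chebyshev polynomials of both kinds, so that Pell's
   equation T^2 + (1 - x^2) U^2 = 1 is an invariant of the recursion. *)
Fixpoint chebyshev (k : nat) : {poly R} * {poly R} :=
  if k is j.+1 then
    let: (T, U) := chebyshev j in ('X * T - (1 - 'X^2) * U, 'X * U + T)
  else (1, 0).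

Lemma size_chebyshev k :
  (size (chebyshev k).1 <= k.+1)%N /\ (size (chebyshev k).2 <= k)%N.
Proof.
elim: k => [|k]; first by rewrite size_poly1 size_poly0.
rewrite /=; case: (chebyshev k) => T U /= [sT sU]; split.
  rewrite (leq_trans (size_polyD _ _)) // geq_max size_polyN.
  rewrite !(leq_trans (size_polyMleq _ _)) ?size_polyX //.
  rewrite -(opprB 'X^2) size_polyN size_XnsubC //; lia.
rewrite (leq_trans (size_polyD _ _)) // geq_max sT andbT.
by rewrite (leq_trans (size_polyMleq _ _)) ?size_polyX.
Qed.

Lemma chebyshev_pell k (x : R) :
  (chebyshev k).1.[x] ^+ 2 + (1 - x ^+ 2) * (chebyshev k).2.[x] ^+ 2 = 1.
Proof.
elim: k => [|k]; first by rewrite hornerC horner0 expr1n expr0n mulr0 addr0.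
rewrite /=; case: (chebyshev k) => T U /= IHk.
rewrite -[RHS]IHk !(hornerD, hornerN, hornerM, hornerXn, hornerX, hornerC); ring.
Qed.

Lemma chebyshev_sqr_le1 k (x : R) : x ^+ 2 <= 1 -> (chebyshev k).1.[x] ^+ 2 <= 1.
Proof.
move=> x1; rewrite -(chebyshev_pell k x) lerDl mulr_ge0 ?sqr_ge0 ?subr_ge0 //.
Qed.

(** Since 1 - x^2 = -((z - 1/z) / 2)^2, one step of the recursion multiplies T + (z - 1/z) U / 2 by
    z and T - (z - 1/z) U / 2 by 1/z. Keeping the factor z - 1/z on the left covers z = 1 and z = -1
    as well. *)
Lemma chebyshev_joukowsky k (z : R) : z != 0 ->
  let x := (z + z^-1) / 2 in
  (chebyshev k).1.[x] = (z ^+ k + z ^- k) / 2 /\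
  (z - z^-1) * (chebyshev k).2.[x] = z ^+ k - z ^- k.
Proof.
move=> z0 x; elim: k => [|k].
  by rewrite /= !hornerE expr0 invr1; split; field.
rewrite /=; case: (chebyshev k) => T U /= [ET EU].
split; rewrite !(hornerD, hornerN, hornerM, hornerXn, hornerX, hornerC).
  have -> : x * T.[x] - (1 - x ^+ 2) * U.[x] =
    x * T.[x] + (z - z^-1) / 4 * ((z - z^-1) * U.[x]).
    by rewrite /x; field.
  by rewrite ET EU /x !exprS; field; rewrite ?expf_neq0.
rewrite mulrDr mulrCA EU ET /x !exprS; field; by rewrite ?expf_neq0.
Qed.

(** The affine map [l] sends a to 1, b to -1 and 0 to x = (b + a) / (b - a) > 1. Hence T_k(l(t)) /
    T_k(x) equals 1 at 0 and is at most 1 / T_k(x) in absolute value on [a, b]. *)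
Lemma residual_poly (a b : R) (k : nat) : 0 < a -> a <= b -> (0 < k)%N ->
  let s := Num.sqrt (b / a) in
  exists r : {poly R}, [/\ (size r <= k.+1)%N, r.[0] = 1 &
    forall t, a <= t -> t <= b -> r.[t] ^+ 2 <= (2 * ((s - 1) / (s + 1)) ^+ k) ^+ 2].
Proof.
move=> a_gt0; rewrite le_eqVlt => /predU1P[<-|ltab] k_gt0 s.
  exists (1 - a^-1 *: 'X); split.
  - rewrite (leq_trans (size_polyD _ _)) // geq_max size_poly1 size_polyN /=.
    by rewrite (leq_trans (size_scale_leq _ _)) // size_polyX.
  - by rewrite hornerD hornerN hornerZ hornerX hornerC mulr0 subr0.
  - move=> t t1 t2; have -> : t = a by apply/eqP; rewrite eq_le t1 t2.
    rewrite hornerD hornerN hornerZ hornerX hornerC mulVf ?gt_eqF //.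
    by rewrite subrr expr0n /= sqr_ge0.
have b_gt0 : 0 < b by exact: lt_trans ltab.
have s2 : s ^+ 2 = b / a by rewrite sqr_sqrtr // divr_ge0 // ltW.
have s_gt1 : 1 < s.
  by rewrite -(sqrtr1 R) ltr_sqrt ?divr_gt0 // ltr_pdivlMr // mul1r.
(* This [z] is the inverse of the convergence factor and solves (z + 1/z) / 2 = x. *)
pose z := (s + 1) / (s - 1).
have z_gt0 : 0 < z by rewrite divr_gt0 // ?subr_gt0 // addr_gt0 // (lt_trans ltr01).
have zV : (s - 1) / (s + 1) = z^-1 by rewrite invf_div.
pose x := (b + a) / (b - a).
have xE : x = (z + z^-1) / 2.
  have bE : b = s ^+ 2 * a by rewrite s2 divfK ?gt_eqF.
  rewrite -zV /z /x bE; field.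
  by rewrite -bE !gt_eqF ?subr_gt0 // addr_gt0 // (lt_trans ltr01).
have [T0 _] := chebyshev_joukowsky k (lt0r_neq0 z_gt0).
set c := (_ / 2 : R) in T0; have {}xE : x = c by [].
(* Dropping the positive term z^(-k) / 2 is what produces the factor 2 of the bound. *)
have Tx_gt : z ^+ k / 2 < (chebyshev k).1.[x].
  rewrite xE T0 ltr_pM2r ?invr_gt0 ?ltr0n // ltrDl invr_gt0 exprn_gt0 //.
have Tx_gt0 : 0 < (chebyshev k).1.[x].
  by apply: lt_trans Tx_gt; rewrite divr_gt0 ?exprn_gt0 ?ltr0n.
pose l : {poly R} := x%:P - (2 / (b - a)) *: 'X.
exists ((chebyshev k).1.[x]^-1 *: ((chebyshev k).1 \Po l)); split.
- rewrite (leq_trans (size_scale_leq _ _)) //.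
  have [sT _] := size_chebyshev k.
  rewrite (leq_trans (size_comp_poly_leq _ _)) // ltnS.
  have : (size l <= 2)%N.
    rewrite (leq_trans (size_polyD _ _)) // geq_max size_polyN.
    rewrite (leq_trans (size_polyC_leq1 _)) //=.
    by rewrite (leq_trans (size_scale_leq _ _)) // size_polyX.
  move: sT; case: (size _) => [|m]; case: (size _) => [|[|[|?]]] //= *;
    by rewrite ?muln0 ?muln1.
- rewrite hornerZ horner_comp hornerD hornerN hornerZ hornerX hornerC.
  by rewrite mulr0 subr0 mulVf ?gt_eqF.
move=> t ta tb.
rewrite hornerZ horner_comp hornerD hornerN hornerZ hornerX hornerC exprMn zV.
have ba : 0 < b - a by rewrite subr_gt0.
apply: (@le_trans _ _ ((chebyshev k).1.[x]^-1 ^+ 2)).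
  rewrite ler_piMr ?sqr_ge0 // chebyshev_sqr_le1 //.
  have -> : x - 2 / (b - a) * t = ((b - t) - (t - a)) / (b - a).
    by rewrite /x; field; rewrite gt_eqF.
  rewrite expr_div_n ler_pdivrMr ?exprn_gt0 // mul1r; nra.
rewrite ler_sqr ?nnegrE ?mulr_ge0 ?exprn_ge0 ?invr_ge0 ?(ltW z_gt0) ?(ltW Tx_gt0) //.
rewrite exprVn ler_pdivlMr ?exprn_gt0 // mulrC ler_pdivrMr // mulrC.
by rewrite -ler_pdivrMr ?ltr0n // ltW.
Qed.
End Chebyshev.

(** * The Euclidean inner product and norm *)

Section DotProduct.
Variables (R : realType) (n : nat).
Implicit Types (u v w : 'cV[R]_n) (a : R).

Lemma dotvE u v : dotv u v = \sum_i u i 0 * v i 0.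
Proof. by rewrite /dotv mxE; apply: eq_bigr => i _; rewrite mxE. Qed.

Lemma dotvC u v : dotv u v = dotv v u.
Proof. by rewrite !dotvE; apply: eq_bigr => i _; rewrite mulrC. Qed.

Lemma dotvDr u v w : dotv u (v + w) = dotv u v + dotv u w.
Proof. by rewrite /dotv mulmxDr mxE. Qed.

Lemma dotvNr u v : dotv u (- v) = - dotv u v.
Proof. by rewrite /dotv mulmxN mxE. Qed.

Lemma dotvZr a u v : dotv u (a *: v) = a * dotv u v.
Proof. by rewrite /dotv -scalemxAr mxE. Qed.

Lemma dotvDl u v w : dotv (u + v) w = dotv u w + dotv v w.
Proof. by rewrite !(dotvC _ w) dotvDr. Qed.

Lemma dotvNl u v : dotv (- u) v = - dotv u v.
Proof. by rewrite !(dotvC _ v) dotvNr. Qed.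

Lemma dotvZl a u v : dotv (a *: u) v = a * dotv u v.
Proof. by rewrite !(dotvC _ v) dotvZr. Qed.

Lemma dotv_ge0 u : 0 <= dotv u u.
Proof. by rewrite dotvE; apply: sumr_ge0 => i _; rewrite -expr2 sqr_ge0. Qed.

Lemma dotv_gt0 u : u != 0 -> 0 < dotv u u.
Proof.
move=> u0; rewrite lt_neqAle dotv_ge0 andbT eq_sym; apply: contra u0.
rewrite dotvE psumr_eq0 => [/allP u0|i _]; last by rewrite -expr2 sqr_ge0.
apply/eqP/colP => i; have := u0 i (mem_index_enum i).
by rewrite /= mulf_eq0 orbb => /eqP ->; rewrite mxE.
Qed.

Lemma vnorm_ge0 u : 0 <= vnorm u. Proof. exact: sqrtr_ge0. Qed.

Lemma vnorm_sqr u : vnorm u ^+ 2 = dotv u u.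
Proof. by rewrite sqr_sqrtr ?dotv_ge0. Qed.

Lemma dotv_mulmxl m (M : 'M[R]_(n, m)) (x : 'cV[R]_m) v :
  dotv (M *m x) v = dotv x (M^T *m v).
Proof. by rewrite /dotv trmx_mul mulmxA. Qed.

End DotProduct.

Lemma vnormZ (R : realType) n a (u : 'cV[R]_n) : vnorm (a *: u) = `|a| * vnorm u.
Proof. by rewrite /vnorm dotvZl dotvZr mulrA -expr2 sqrtrM ?sqr_ge0 // sqrtr_sqr. Qed.

(** * Spectral bounds for a symmetric matrix, and Krylov vectors as polynomials in it *)

Section Spectral.
Variables (R : realType) (n : nat) (A : 'M[R]_n.+1).
Hypothesis symA : A^T = A.

Lemma trmx_horner_mx (p : {poly R}) : (horner_mx A p)^T = horner_mx A p.
Proof.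
elim/poly_ind: p => [|p c IHp]; first by rewrite rmorph0 trmx0.
rewrite rmorphD linearD /= horner_mx_C tr_scalar_mx; congr (_ + _).
rewrite [in LHS]mulrC !rmorphM /= horner_mx_X.
by rewrite trmx_mul IHp symA.
Qed.

(** The polynomial M - p^2 is nonnegative on the spectrum, and p(A) is symmetric, so the quadratic
    form of p(A)^2 at [v] is the squared norm of p(A) v. *)
Lemma dotv_horner_mx_le (p : {poly R}) (M : R) (v : 'cV[R]_n.+1) :
  (forall a, eigenvalue A a -> p.[a] ^+ 2 <= M) ->
  dotv (horner_mx A p *m v) (horner_mx A p *m v) <= M * dotv v v.
Proof.
move=> pM; have /psd_horner_mx : forall a, eigenvalue A a -> 0 <= (M%:P - p ^+ 2).[a].
  by move=> a /pM; rewrite hornerD hornerN hornerC horner_exp subr_ge0.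
move/(_ symA v); rewrite rmorphB rmorphXn /= horner_mx_C mulmxBl mul_scalar_mx.
rewrite dotvDr dotvNr dotvZr subr_ge0 expr2 -mulmxA.
by rewrite dotv_mulmxl trmx_horner_mx.
Qed.

Lemma rayleigh_ge (a0 : R) (v : 'cV[R]_n.+1) :
  (forall a, eigenvalue A a -> a0 <= a) -> a0 * dotv v v <= dotv v (A *m v).
Proof.
move=> Age; have /psd_horner_mx : forall a, eigenvalue A a -> 0 <= ('X - a0%:P).[a].
  by move=> a /Age; rewrite hornerXsubC subr_ge0.
move/(_ symA v); rewrite rmorphB /= horner_mx_C horner_mx_X mulmxBl mul_scalar_mx.
by rewrite dotvDr dotvNr dotvZr subr_ge0.
Qed.

Lemma rayleigh_le (a1 : R) (v : 'cV[R]_n.+1) :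
  (forall a, eigenvalue A a -> a <= a1) -> dotv v (A *m v) <= a1 * dotv v v.
Proof.
move=> Ale; have /psd_horner_mx : forall a, eigenvalue A a -> 0 <= (a1%:P - 'X).[a].
  by move=> a /Ale; rewrite hornerD hornerN hornerC hornerX subr_ge0.
move/(_ symA v); rewrite rmorphB /= horner_mx_C horner_mx_X mulmxBl mul_scalar_mx.
by rewrite dotvDr dotvNr dotvZr subr_ge0.
Qed.

(** A normalized eigenvector attains the value a1 + l. Boundedness must be shown first, since [sup]
    of an unbounded set is a default value. *)
Lemma eigenvalue_le_opnorm (a1 l : R) :
  eigenvalue A a1 -> (forall a, eigenvalue A a -> 0 <= a + l <= a1 + l) ->
  a1 + l <= opnorm (A + l%:M).
Proof.
move=> a1A Al; have /andP[a1l _] := Al _ a1A.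
have ub : has_ubound [set vnorm ((A + l%:M) *m x) |
    x in [set x : 'cV[R]_n.+1 | vnorm x <= 1]]%classic.
  exists (a1 + l) => _ [x /= x1 <-].
  rewrite -ler_sqr ?nnegrE ?vnorm_ge0 // vnorm_sqr.
  have -> : A + l%:M = horner_mx A ('X + l%:P).
    by rewrite rmorphD /= horner_mx_X horner_mx_C.
  apply: (@le_trans _ _ ((a1 + l) ^+ 2 * dotv x x)).
    apply: dotv_horner_mx_le => a /Al /andP[al0 al].
    by rewrite hornerD hornerX hornerC ler_sqr ?nnegrE.
  by rewrite ler_piMr ?sqr_ge0 // -vnorm_sqr exprn_ile1 ?vnorm_ge0.
(* [eigenvalueP] gives a row eigenvector; by symmetry of A its transpose is a column eigenvector. *)
have /eigenvalueP[v vA v0] := a1A.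
have vT0 : v^T != 0 by rewrite trmx_eq0.
have nv : 0 < vnorm v^T by rewrite sqrtr_gt0 dotv_gt0.
apply: (ub_le_sup ub); exists ((vnorm v^T)^-1 *: v^T) => /=.
  by rewrite vnormZ ger0_norm ?invr_ge0 ?vnorm_ge0 // mulVf ?gt_eqF.
have -> : (A + l%:M) *m ((vnorm v^T)^-1 *: v^T) = (a1 + l) *: ((vnorm v^T)^-1 *: v^T).
  rewrite mulmxDl mul_scalar_mx [RHS]scalerDl; congr (_ + _).
  by rewrite -scalemxAr -[A in LHS]symA -trmx_mul vA linearZ /= !scalerA mulrC.
rewrite !vnormZ (ger0_norm a1l) ger0_norm ?invr_ge0 ?vnorm_ge0 //.
by rewrite mulVf ?gt_eqF // mulr1.
Qed.

Lemma horner_mx_krylov (g : 'cV[R]_n.+1) k (s : {poly R}) :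
  (size s <= k)%N -> ((horner_mx A s *m g)^T <= krylov A g k)%MS.
Proof.
move=> sk; have -> : s = \poly_(i < k) s`_i.
  apply/polyP => i; rewrite coef_poly; case: ltnP => // ki.
  by rewrite nth_default // (leq_trans sk).
rewrite poly_def rmorph_sum /= mulmx_suml linear_sum /=.
apply: summx_sub => i _; rewrite linearZ /= rmorphXn /= horner_mx_X.
rewrite -scalemxAl linearZ /= scalemx_sub //.
by have := row_sub i (krylov A g k); rewrite rowK.
Qed.

End Spectral.

(** * Orthogonal projection and approximation on a sphere *)

Section OrthonormalColumns.
Variables (R : realType) (n k : nat) (Q : 'M[R]_(n, k)).
Hypothesis QQ : Q^T *m Q = 1%:M.

Lemma dotv_isometry (u v : 'cV[R]_k) : dotv (Q *m u) (Q *m v) = dotv u v.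
Proof. by rewrite dotv_mulmxl mulmxA QQ mul1mx. Qed.

Lemma vnorm_isometry (u : 'cV[R]_k) : vnorm (Q *m u) = vnorm u.
Proof. by rewrite /vnorm dotv_isometry. Qed.

(** Pythagoras for the orthogonal projection [Q *m Q^T]. *)
Lemma dotv_proj_residual (x : 'cV[R]_n) :
  dotv ((1%:M - Q *m Q^T) *m x) ((1%:M - Q *m Q^T) *m x) =
  dotv x x - dotv (Q^T *m x) (Q^T *m x).
Proof.
rewrite mulmxBl mul1mx -mulmxA !(dotvDl, dotvDr, dotvNl, dotvNr).
rewrite dotv_isometry [dotv x (Q *m _)]dotvC dotv_mulmxl; ring.
Qed.

Lemma proj_residual_eq0 (u : 'cV[R]_n) :
  (u^T <= Q^T)%MS -> (1%:M - Q *m Q^T) *m u = 0.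
Proof.
case/submxP => D /(congr1 trmx); rewrite trmxK trmx_mul trmxK => ->.
by rewrite mulmxBl mul1mx -mulmxA [Q^T *m _]mulmxA QQ mul1mx subrr.
Qed.

(* The witness is Q^T x rescaled to norm D.  If Q^T x = 0 then e = D and any
   vector of norm D works, whence the hypothesis on h. *)
Lemma sphere_approx (x : 'cV[R]_n) (h : 'cV[R]_k) (D : R) :
  0 < D -> vnorm x = D -> vnorm h = D ->
  let e := vnorm ((1%:M - Q *m Q^T) *m x) in
  exists2 y : 'cV[R]_k, vnorm y = D &
    dotv (Q *m y - x) (Q *m y - x) <= (1 + e ^+ 2 / D ^+ 2) * e ^+ 2.
Proof.
move=> D_gt0 xD hD e.
have x2 : dotv x x = D ^+ 2 by rewrite -vnorm_sqr xD.
set p := Q^T *m x; set c := vnorm p.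
have e2 : e ^+ 2 = D ^+ 2 - c ^+ 2 by rewrite !vnorm_sqr dotv_proj_residual x2.
have dist y : dotv (Q *m y - x) (Q *m y - x) = dotv y y + D ^+ 2 - 2 * dotv y p.
  rewrite !(dotvDl, dotvDr, dotvNl, dotvNr) dotv_isometry x2.
  rewrite [dotv x (Q *m _)]dotvC dotv_mulmxl; ring.
have c_ge0 : 0 <= c by exact: vnorm_ge0.
have cD : c <= D.
  rewrite -ler_sqr ?nnegrE ?(ltW D_gt0) // -subr_ge0 -e2; exact: sqr_ge0.
have [c0|c0] := eqVneq c 0.
  exists h => //; rewrite dist e2 c0 -vnorm_sqr hD expr0n subr0.
  rewrite divff ?expf_neq0 ?gt_eqF //.
  have -> : dotv h p = 0.
    suff -> : p = 0 by rewrite /dotv mulmx0 mxE.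
    by apply/eqP; apply: contraTT isT => /dotv_gt0; rewrite -vnorm_sqr -/c c0 expr0n ltxx.
  rewrite mulr0 subr0; lra.
have c_gt0 : 0 < c by rewrite lt_neqAle eq_sym c0.
exists ((D / c) *: p).
  by rewrite vnormZ -/c ger0_norm ?divfK // divr_ge0 // ltW.
rewrite dist dotvZl dotvZr dotvZl -vnorm_sqr -/c e2.
(* [t] is the cosine of the angle between x and the range of [Q]. After division by D^2 the claim is
   2 - 2t <= (2 - t^2)(1 - t^2), whose two sides differ by t (1 - t)^2 (t + 2). *)
set t := c / D.
have t0 : 0 <= t by rewrite divr_ge0 // ltW.
have t1 : t <= 1 by rewrite ler_pdivrMr // mul1r.
have -> : D / c * (D / c * c ^+ 2) + D ^+ 2 - 2 * (D / c * c ^+ 2) = D ^+ 2 * (2 - 2 * t).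
  by rewrite /t; field; rewrite !gt_eqF.
have -> : (1 + (D ^+ 2 - c ^+ 2) / D ^+ 2) * (D ^+ 2 - c ^+ 2) =
   D ^+ 2 * ((2 - t ^+ 2) * (1 - t ^+ 2)).
  by rewrite /t; field; rewrite gt_eqF.
rewrite ler_pM2l ?exprn_gt0 //.
have -> : (2 - t ^+ 2) * (1 - t ^+ 2) = 2 - 2 * t + t * (1 - t) ^+ 2 * (t + 2) .
  ring.
rewrite lerDl mulr_ge0 ?(addr_ge0 t0 (ler0n _ 2)) //.
by rewrite mulr_ge0 ?sqr_ge0.
Qed.

End OrthonormalColumns.

(** * Distance from the solution to the Krylov space *)

Lemma krylov_residual_le (R : realType) (n k : nat) (A : 'M[R]_n.+1)
    (g x : 'cV[R]_n.+1) (Q : 'M[R]_(n.+1, k)) (a1 an l : R) :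
  A^T = A -> an <= a1 -> (forall a, eigenvalue A a -> an <= a <= a1) ->
  0 < an + l -> (A + l%:M) *m x = - g -> (0 < k)%N -> Q^T *m Q = 1%:M ->
  (krylov A g k <= Q^T)%MS ->
  let s := Num.sqrt ((a1 + l) / (an + l)) in
  vnorm ((1%:M - Q *m Q^T) *m x) <= 2 * ((s - 1) / (s + 1)) ^+ k * vnorm x.
Proof.
move=> symA le_an_a1 Aa anl Ax k_gt0 QQ KQ /=; set s := Num.sqrt _.
have [|r [szr r0 rle]] := @residual_poly R (an + l) (a1 + l) k anl _ k_gt0.
  by rewrite lerD2r.
pose p := r \Po ('X + l%:P).
have pE a : p.[a] = r.[a + l] by rewrite horner_comp hornerD hornerX hornerC.
(* As r(0) = 1, the polynomial 1 - p factors as t (X + l), so p(A) x = x - t(A) (A + l) x = x + t(A)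
   g. The factor X + l lowers the degree by one, which puts t(A) g in the k-th Krylov space. *)
have : root (1 - p) (- l) by rewrite /root hornerD hornerN hornerC pE addNr r0 subrr.
case/factor_theorem => t; rewrite polyCN opprK => tE.
have szt : (size t <= k)%N.
  have [->|t0] := eqVneq t 0; first by rewrite size_poly0.
  have := congr1 (fun q : {poly R} => size q) tE.
  rewrite -(opprK l%:P) -polyCN size_Mmonic ?monicXsubC // size_XsubC addn2 /= => szE.
  rewrite -ltnS -szE (leq_trans (size_polyD _ _)) // geq_max size_poly1 size_polyN.
  by rewrite /p -(opprK l%:P) -polyCN size_comp_poly2 ?size_XsubC.
pose u := horner_mx A t *m g.
have pAx : horner_mx A p *m x = x + u.
  have -> : p = 1 - t * ('X + l%:P) by rewrite -tE opprB addrC subrK.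
  rewrite rmorphB rmorph1 rmorphM rmorphD /= horner_mx_X horner_mx_C.
  by rewrite mulmxBl mul1mx -mulmxA Ax mulmxN opprK.
have Ku : (1%:M - Q *m Q^T) *m u = 0.
  by apply: proj_residual_eq0 => //; apply: submx_trans KQ; exact: horner_mx_krylov.
have -> : (1%:M - Q *m Q^T) *m x = (1%:M - Q *m Q^T) *m (horner_mx A p *m x).
  by rewrite pAx mulmxDr Ku addr0.
have s_ge1 : 1 <= s.
  by rewrite -(sqrtr1 R) ler_wsqrtr // ler_pdivlMr // mul1r lerD2r.
have rho_ge0 : 0 <= (s - 1) / (s + 1).
  by rewrite divr_ge0 ?subr_ge0 ?addr_ge0 // (le_trans ler01).
rewrite -ler_sqr ?nnegrE ?mulr_ge0 ?vnorm_ge0 ?exprn_ge0 // exprMn !vnorm_sqr.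
rewrite dotv_proj_residual //.
apply: (@le_trans _ _ (dotv (horner_mx A p *m x) (horner_mx A p *m x))).
  by rewrite lerBlDr lerDl dotv_ge0.
apply: dotv_horner_mx_le => // a /Aa /andP[ana aa1].
by rewrite pE rle // lerD2r.
Qed.

(** * The objective on a sphere and in Lanczos coordinates *)

Lemma trs_obj_diff (R : realType) (n : nat) (A : 'M[R]_n) (g x y : 'cV[R]_n) (l : R) :
  A^T = A -> (A + l%:M) *m x = - g -> vnorm y = vnorm x ->
  trs_obj A g y - trs_obj A g x = 2^-1 * dotv (y - x) ((A + l%:M) *m (y - x)).
Proof.
move=> symA Ax yx.
have yx2 : dotv y y = dotv x x by rewrite -!vnorm_sqr yx.
have gE : g = - (A *m x + l *: x) by rewrite -mul_scalar_mx -mulmxDl Ax opprK.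
have sym : dotv x (A *m y) = dotv y (A *m x) by rewrite dotvC dotv_mulmxl symA.
rewrite /trs_obj mulmxDl mul_scalar_mx gE mulmxBr scalerBr.
rewrite !(dotvDl, dotvDr, dotvNl, dotvNr, dotvZr) sym (dotvC x y) yx2.
by field.
Qed.

(** This carries the minimality of [h] in the reduced problem over to [Q *m h] in the Krylov
    space. *)
Lemma trs_obj_isometry (R : realType) (n k : nat) (A : 'M[R]_n) (g : 'cV[R]_n)
    (Q : 'M[R]_(n, k)) (h : 'cV[R]_k) :
  trs_obj (Q^T *m A *m Q) (Q^T *m g) h = trs_obj A g (Q *m h).
Proof. by rewrite /trs_obj !dotv_mulmxl !mulmxA. Qed.

Lemma lanczos_basis_orthonormal (R : realType) (n : nat) (A : 'M[R]_n)
    (g : 'cV[R]_n) (k : nat) (q : nat -> 'cV[R]_n) :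
  lanczos_basis A g k q -> (Qmat q k)^T *m Qmat q k = 1%:M.
Proof.
case=> qq _; apply/matrixP => i j; rewrite !mxE.
rewrite -(qq i j (ltn_ord i) (ltn_ord j)) dotvE.
by apply: eq_bigr => m _; rewrite !mxE.
Qed.

Lemma lanczos_basis_krylov (R : realType) (n : nat) (A : 'M[R]_n)
    (g : 'cV[R]_n) (k : nat) (q : nat -> 'cV[R]_n) :
  lanczos_basis A g k q -> (krylov A g k <= (Qmat q k)^T)%MS.
Proof.
case=> _ [_ /(_ k (leqnn k)) /andP[_ qK]]; apply: submx_trans qK _.
suff -> : \matrix_(i < k) (q i)^T = (Qmat q k)^T by [].
by apply/matrixP => i j; rewrite !mxE.
Qed.

(** As g is a multiple of the first basis vector, the projected linear term is the one of the
    reduced problem. *)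
Lemma lanczos_basis_start (R : realType) (n : nat) (A : 'M[R]_n)
    (g : 'cV[R]_n) (k : nat) (q : nat -> 'cV[R]_n) :
  g != 0 -> (0 < k)%N -> lanczos_basis A g k q -> (Qmat q k)^T *m g = vnorm g *: e1 R k.
Proof.
move=> g0 k_gt0 [qq [q0 _]].
have gE : g = vnorm g *: q 0%N.
  by rewrite q0 scalerA divff ?scale1r // gt_eqF // sqrtr_gt0 dotv_gt0.
rewrite [in LHS]gE -scalemxAr; congr (_ *: _); apply/colP => i.
by rewrite !mxE -(qq i 0%N) // dotvE; apply: eq_bigr => m _; rewrite !mxE.
Qed.

(** * Assembly of the gap and distance bounds *)

Theorem theorem3p3 (R : realType) (n : nat) (A : 'M[R]_n) (g : 'cV[R]_n) (Delta : R)
  (alpha1 alphan : R) (xopt : 'cV[R]_n) (lopt : R)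
  (kmax k : nat) (q : nat -> 'cV[R]_n) (h : 'cV[R]_k) (lk : R) :
  A^T = A ->
  eigenvalue A alpha1 -> (forall a, eigenvalue A a -> a <= alpha1) ->
  eigenvalue A alphan -> (forall a, eigenvalue A a -> alphan <= a) ->
  g != 0 -> 0 < Delta ->
  (* x_opt is a global minimizer of the TRS with multiplier lambda_opt *)
  vnorm xopt <= Delta ->
  (forall x : 'cV[R]_n, vnorm x <= Delta -> trs_obj A g xopt <= trs_obj A g x) ->
  0 <= lopt -> (A + lopt%:M) *m xopt = - g ->
  lopt * (Delta - vnorm xopt) = 0 -> psd (A + lopt%:M) ->
  (* easy case *)
  - alphan < lopt ->
  (* Lanczos process *)
  first_breakdown A g kmax -> (1 <= k <= kmax)%N ->
  lanczos_basis A g k q ->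
  let Q := Qmat q k in
  let T := Q^T *m A *m Q in
  (* h_k solves the reduced problem with multiplier lambda_k *)
  vnorm h <= Delta ->
  (forall h' : 'cV[R]_k, vnorm h' <= Delta ->
     trs_obj T (vnorm g *: e1 R k) h <= trs_obj T (vnorm g *: e1 R k) h') ->
  0 <= lk -> (T + lk%:M) *m h = - (vnorm g *: e1 R k) ->
  lk * (Delta - vnorm h) = 0 -> psd (T + lk%:M) ->
  let xk := Q *m h in
  vnorm xopt = Delta -> vnorm xk = Delta ->
  let f := trs_obj A g in
  let Aopt := A + lopt%:M in
  let kappa := (alpha1 + lopt) / (alphan + lopt) in
  let eps := vnorm ((1%:M - Q *m Q^T) *m xopt) in
  let rho := (Num.sqrt kappa - 1) / (Num.sqrt kappa + 1) in
  (0 <= f xk - f xopt /\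
   f xk - f xopt <= 2^-1 * opnorm Aopt * (1 + eps ^+ 2 / Delta ^+ 2) * eps ^+ 2 /\
   2^-1 * opnorm Aopt * (1 + eps ^+ 2 / Delta ^+ 2) * eps ^+ 2
     <= 2 * opnorm Aopt * (Delta ^+ 2 + eps ^+ 2) * rho ^+ (2 * k)) /\
  (vnorm (xk - xopt) <= Num.sqrt (kappa * (1 + eps ^+ 2 / Delta ^+ 2)) * eps /\
   Num.sqrt (kappa * (1 + eps ^+ 2 / Delta ^+ 2)) * eps
     <= 2 * Num.sqrt (kappa * (Delta ^+ 2 + eps ^+ 2)) * rho ^+ k).
Proof.
(* Polynomials in a matrix require a positive dimension; in dimension 0 no [g] is nonzero. *)
case: n A g xopt q => [|n] A g xopt q symA A1 Ale An Age g0 D_gt0;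
  first by rewrite flatmx0 eqxx in g0.
move=> _ xopt_min _ Axopt _ _ anl _ /andP[k_gt0 _] lq Q T _ hmin _ _ _ _ xk.
move=> xoptD xkD f Aopt kappa eps rho.
have QQ : Q^T *m Q = 1%:M := lanczos_basis_orthonormal lq.
have KQ : (krylov A g k <= Q^T)%MS := lanczos_basis_krylov lq.
have Qg : Q^T *m g = vnorm g *: e1 R k := lanczos_basis_start g0 k_gt0 lq.
have an_gt0 : 0 < alphan + lopt by lra.
have le_an_a1 : alphan <= alpha1 := Ale _ An.
have a1_gt0 : 0 < alpha1 + lopt by lra.
have kappa_gt0 : 0 < kappa by rewrite divr_gt0.
have kappa_ge1 : 1 <= Num.sqrt kappa.
  by rewrite -(sqrtr1 R) ler_wsqrtr // ler_pdivlMr // mul1r lerD2r.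
have rho_ge0 : 0 <= rho.
  by rewrite divr_ge0 ?subr_ge0 ?addr_ge0 // (le_trans ler01).
have eps_ge0 : 0 <= eps by exact: vnorm_ge0.
have eps_le : eps <= 2 * rho ^+ k * Delta.
  rewrite -xoptD; apply: (@krylov_residual_le _ _ _ A g) => //.
  by move=> a Aa; rewrite Ale ?Age.
have eps2_le : eps ^+ 2 <= 4 * rho ^+ (2 * k) * Delta ^+ 2.
  have -> : 4 * rho ^+ (2 * k) * Delta ^+ 2 = (2 * rho ^+ k * Delta) ^+ 2.
    by rewrite mulnC exprM; ring.
  by rewrite ler_sqr ?nnegrE // (le_trans eps_ge0).
have op_ge : alpha1 + lopt <= opnorm Aopt.
  apply: eigenvalue_le_opnorm => // a Aa; rewrite lerD2r Ale // andbT.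
  by have := Age _ Aa; lra.
set E := 1 + eps ^+ 2 / Delta ^+ 2.
have D2_gt0 : 0 < Delta ^+ 2 by rewrite exprn_gt0.
have ED : Delta ^+ 2 + eps ^+ 2 = E * Delta ^+ 2.
  by rewrite /E mulrDl mul1r divfK ?gt_eqF.
have E_gt0 : 0 < E by rewrite ltr_pwDl // divr_ge0 ?sqr_ge0.
have kE_ge0 : 0 <= kappa * E := mulr_ge0 (ltW kappa_gt0) (ltW E_gt0).
have hD : vnorm h = Delta by rewrite -xkD vnorm_isometry.
have [y yD ydist] := sphere_approx QQ D_gt0 xoptD hD.
rewrite -/eps -/E in ydist.
have f_diff z : vnorm z = Delta ->
    f z - f xopt = 2^-1 * dotv (z - xopt) (Aopt *m (z - xopt)).
  by move=> zD; apply: trs_obj_diff => //; rewrite zD.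
have f_ge0 : 0 <= f xk - f xopt by rewrite subr_ge0 xopt_min ?xkD.
(* The largest eigenvalue of [Aopt] is kept here instead of its norm, so that division by
   [alphan + lopt] gives [kappa] in the distance bound; [op_ge] passes to the norm for the gap
   bound. *)
have f_le : f xk - f xopt <= 2^-1 * (alpha1 + lopt) * (E * eps ^+ 2).
  apply: (@le_trans _ _ (f (Q *m y) - f xopt)).
    by rewrite lerD2r /f /xk -!trs_obj_isometry Qg hmin ?yD.
  rewrite f_diff ?vnorm_isometry // -mulrA ler_pM2l ?invr_gt0 ?ltr0n //.
  apply: (@le_trans _ _ ((alpha1 + lopt) * dotv (Q *m y - xopt) (Q *m y - xopt))).
    rewrite mulmxDl mul_scalar_mx dotvDr dotvZr mulrDl lerD2r.
    exact: rayleigh_le.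
  by rewrite ler_pM2l.
(* The smallest eigenvalue of [Aopt], positive in the easy case, turns the gap into a distance. *)
have dist_le : (alphan + lopt) * vnorm (xk - xopt) ^+ 2 <= 2 * (f xk - f xopt).
  rewrite f_diff // mulVKf ?pnatr_eq0 // vnorm_sqr mulmxDl mul_scalar_mx.
  by rewrite [dotv _ (_ *m _ + _)]dotvDr dotvZr mulrDl lerD2r; exact: rayleigh_ge.
split; split => //; last first.
- have -> : Num.sqrt (kappa * (Delta ^+ 2 + eps ^+ 2)) =
      Num.sqrt (kappa * E) * Delta.
    rewrite ED mulrA sqrtrM //.
    by rewrite sqrtr_sqr ger0_norm ?(ltW D_gt0).
  have -> : 2 * (Num.sqrt (kappa * E) * Delta) * rho ^+ k =
      Num.sqrt (kappa * E) * (2 * rho ^+ k * Delta) by ring.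
  by rewrite ler_wpM2l ?sqrtr_ge0.
- rewrite -ler_sqr ?nnegrE ?mulr_ge0 ?vnorm_ge0 ?sqrtr_ge0 //.
  rewrite exprMn (sqr_sqrtr kE_ge0).
  rewrite -(ler_pM2l an_gt0); apply: (le_trans dist_le).
  have -> : (alphan + lopt) * (kappa * E * eps ^+ 2) =
    2 * (2^-1 * (alpha1 + lopt) * (E * eps ^+ 2)).
    by rewrite /kappa; field; rewrite gt_eqF.
  by rewrite ler_pM2l ?ltr0n.
split.
  apply: (le_trans f_le); rewrite -!mulrA ler_pM2l ?invr_gt0 ?ltr0n //.
  by rewrite ler_wpM2r // mulr_ge0 ?sqr_ge0 // ltW.
have op_ge0 : 0 <= opnorm Aopt by rewrite (le_trans _ op_ge) // ltW.
have -> : 2 * opnorm Aopt * (Delta ^+ 2 + eps ^+ 2) * rho ^+ (2 * k) =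
  2^-1 * opnorm Aopt * E * (4 * rho ^+ (2 * k) * Delta ^+ 2).
  by rewrite ED; field.
by rewrite ler_wpM2l // !mulr_ge0 ?invr_ge0 ?ler0n // ltW.
Qed.
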